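(* Let $K:\mathbb{Z}^2\to[0,\infty)$ satisfy $\sup_{k,l\in\mathbb{Z}}K(k,l)\le C_K$ for some $C_K\in(0,\infty)$, and let $Q$ be the associated collision operator. Let $f_0\in\ell_1(\mathbb{Z})$ with $f_0(k)\ge0$ for all $k\in\mathbb{Z}$. Then the corresponding ($\ell_1(\mathbb{Z})$-)solution $f$ of $\dot f(t)=Q(f(t))$, $t>0$, $f(0)=f_0$, exists for all $t\ge0$, is nonnegative (i.e. $f(t)(k)\ge 0$ for all $t\ge 0$, $k\in\mathbb{Z}$), and satisfies $m(f(t))=m(f_0)$ for all $t\in[0,\infty)$.
   Context: $\ell_1(\mathbb{Z})$ is the Banach space of real functions $g:\mathbb{Z}\to\mathbb{R}$ with $\|g\|_1=\sum_{k\in\mathbb{Z}}|g(k)|<\infty$. For $g\in\ell_1(\mathbb{Z})$ the total mass is $m(g)=\sum_{k\in\mathbb{Z}}g(k)$. The collision operator associated with $K$ is $Q(f)=Q(f,f)$, where for $k\in\mathbb{Z}$ $$Q(f,g)(k)=\sum_{l\in\mathbb{Z}}\Big(K(l,k-1)g(l)f(k-1)-K(k,l-1)f(k)g(l-1)-K(l,k)g(l)f(k)+K(k+1,l-1)f(k+1)g(l-1)\Big).$$ For bounded $K$, $Q$ maps $\ell_1(\mathbb{Z})$ into itself. The ($\ell_1(\mathbb{Z})$-)solution is the unique maximal solution $f\in C^1([0,t^+(f_0));\ell_1(\mathbb{Z}))$ of the initial value problem, where $t^+(f_0)\in(0,\infty]$ is the maximal existence time. *)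

(* Defs.v *)
From HB Require Import structures.
From mathcomp Require Import all_boot all_order all_algebra.
From mathcomp Require Import all_classical all_reals all_analysis.

Set Implicit Arguments.
Unset Strict Implicit.
Unset Printing Implicit Defensive.

Import Order.TTheory GRing.Theory Num.Theory.
Import numFieldNormedType.Exports.

Local Open Scope classical_set_scope.
Local Open Scope ring_scope.

(* The sum over the integers of an absolutely summable g. The library's \esum
   is only meaningful for nonnegative terms, whence the splitting into positive
   and negative parts; the value is junk when g is not absolutely summable. *)
Definition sumZ (R : realType) (g : int -> R) : R :=
  fine (\esum_(k in [set: int]) (EFin \o g)^\+ k
        - \esum_(k in [set: int]) (EFin \o g)^\- k)%E.

Section l1_space.
Variable R : realType.

Definition l1_pred : {pred (int -> R)} :=
  mem [set g : int -> R | summable [set: int] (EFin \o g)].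

Lemma l1_predE (g : int -> R) :
  (g \in l1_pred) = (\esum_(k in [set: int]) `|g k|%:E < +oo)%E.
Proof. by apply/idP/idP => [/set_mem //|h]; apply/mem_set. Qed.

Lemma esum_normZ (a : R) (g : int -> R) :
  (\esum_(k in [set: int]) `|a * g k|%:E
   <= `|a|%:E * \esum_(k in [set: int]) `|g k|%:E)%E.
Proof.
apply: ge_ereal_sup => _ [A [finA _] <-].
under eq_fsbigr do rewrite normrM EFinM.
rewrite -ge0_mule_fsumr; last by move=> i; rewrite lee_fin.
rewrite lee_wpmul2l ?lee_fin//.
by apply: ereal_sup_ubound; exists A.
Qed.

Lemma l1_submod_closed : submod_closed l1_pred.
Proof.
split.
  by rewrite l1_predE esum1 ?ltry// => k _; rewrite normr0.
move=> a f g fl gl; have := esum_normZ a f.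
move: fl gl; rewrite !l1_predE => fl gl af.
apply: (@le_lt_trans _ _ (\esum_(k in [set: int]) (`|a * f k|%:E + `|g k|%:E))%E).
  by apply: le_esum => k _; rewrite -EFinD lee_fin ler_normD.
rewrite esumD ?lte_add_pinfty//; [|by move=> *; rewrite lee_fin..].
apply: (le_lt_trans af); rewrite lte_mul_pinfty//.
Qed.

HB.instance Definition _ :=
  GRing.isSubmodClosed.Build R (int -> R) l1_pred l1_submod_closed.

Record l1 := L1 { l1_val :> int -> R; l1_valP : l1_val \in l1_pred }.

HB.instance Definition _ := [isSub for l1_val].
HB.instance Definition _ := [Choice of l1 by <:].
HB.instance Definition _ := [SubChoice_isSubLmodule of l1 by <:].

Definition l1_norm (g : l1) : R := fine (\esum_(k in [set: int]) `|g k|%:E)%E.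

Lemma l1_normE (g : l1) :
  ((l1_norm g)%:E = \esum_(k in [set: int]) `|g k|%:E)%E.
Proof.
rewrite /l1_norm fineK// ge0_fin_numE -?l1_predE ?l1_valP//.
by apply: esum_ge0 => k _; rewrite lee_fin.
Qed.

Lemma l1_norm_triangle (f g : l1) : l1_norm (f + g) <= l1_norm f + l1_norm g.
Proof.
rewrite -lee_fin EFinD !l1_normE -esumD; [|by move=> *; rewrite lee_fin..].
by apply: le_esum => k _; rewrite -EFinD lee_fin ler_normD.
Qed.

Lemma l1_normZ (a : R) (g : l1) : l1_norm (a *: g) = `|a| * l1_norm g.
Proof.
have leZ b (h : l1) : l1_norm (b *: h) <= `|b| * l1_norm h.
  by rewrite -lee_fin EFinM !l1_normE; exact: esum_normZ.
apply/eqP; rewrite eq_le leZ /=; have [->|a0] := eqVneq a 0.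
  by rewrite normr0 mul0r fine_ge0// esum_ge0// => k _; rewrite lee_fin.
have := leZ a^-1 (a *: g); rewrite scalerA mulVf// scale1r.
by rewrite normfV ler_pdivlMl ?normr_gt0.
Qed.

Lemma l1_norm_eq0 (g : l1) : l1_norm g = 0 -> g = 0.
Proof.
move=> g0; apply/val_inj/funext => k /=; apply/normr0_eq0/eqP.
rewrite eq_le normr_ge0 andbT -lee_fin -g0 l1_normE.
apply: ereal_sup_ubound; exists [set k]; last by rewrite fsbig_set1.
by split; [exact: finite_set1 | exact: subsetT].
Qed.

HB.instance Definition _ := Lmodule_isNormed.Build R l1
  l1_norm_triangle l1_normZ l1_norm_eq0.

End l1_space.

Section collision_dynamics.
Variables (R : realType) (K : int -> int -> R).

Definition mass (g : l1 R) : R := sumZ g.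

Definition collision2 (f g : int -> R) (k : int) : R :=
  sumZ (fun l => K l (k - 1) * g l * f (k - 1)
                 - K k (l - 1) * f k * g (l - 1)
                 - K l k * g l * f k
                 + K (k + 1) (l - 1) * f (k + 1) * g (l - 1)).

Definition collision (f : int -> R) : int -> R := collision2 f f.

(* The class C^1([0, T); l1), for 0 < T <= +oo: the derivative is one-sided
   at 0, and the values of f outside [0, T) are irrelevant. *)
Definition C1_on (T : \bar R) (f : R -> l1 R) : Prop :=
  exists df : R -> l1 R,
    [/\ {within [set t | 0 <= t /\ (t%:E < T)%E], continuous df},
        forall t : R, 0 < t -> (t%:E < T)%E -> is_derive t 1 f (df t)
      & h^-1 *: (f h - f 0) @[h --> 0^'+] --> df 0].

Definition is_solution (f0 : l1 R) (T : \bar R) (f : R -> l1 R) : Prop :=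
  [/\ (0 < T)%E,
      C1_on T f,
      f 0 = f0
    & forall t : R, 0 < t -> (t%:E < T)%E ->
        derive1 f t = collision (f t) :> (int -> R)].

Definition is_maximal_solution (f0 : l1 R) (T : \bar R) (f : R -> l1 R) : Prop :=
  is_solution f0 T f /\
  forall (S : \bar R) (g : R -> l1 R), is_solution f0 S g -> (T <= S)%E ->
    (forall t : R, 0 <= t -> (t%:E < T)%E -> g t = f t) -> S = T.

End collision_dynamics.

(* Main.v *)
(* Write lam = 2 C m(f0). Adding 2 C m(f) f to the collision operator gives a
   quadratic map B(f, f) with nonnegative coefficients and
   m(B(f, g)) = 2 C m(f) m(g). The substitutions f(t) = e^(-lam t) u and
   z = 1 - e^(-lam t) turn f' = B(f, f) - lam f into lam du/dz = B(u, u), which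
   is solved by the power series (a Wild sum) u = sum_n z^n v_n with v_0 = f0
   and lam (n+1) v_(n+1) = sum_(i <= n) B(v_i, v_(n-i)). By induction each v_n
   is nonnegative with mass m(f0), so the series converges for 0 <= z < 1, that
   is for all t >= 0, to a nonnegative solution of constant mass. A mean value
   inequality, obtained by testing against finitely supported sign sequences,
   upgrades this coordinatewise solution to a C^1 curve in l1 and yields
   uniqueness by a Gronwall argument. *)

Require Import Defs.
From mathcomp Require Import all_boot all_order all_algebra.
From mathcomp Require Import all_classical all_reals all_analysis.
From mathcomp Require Import ring lra.

Set Implicit Arguments.
Unset Strict Implicit.
Unset Printing Implicit Defensive.

Import Order.TTheory GRing.Theory Num.Theory.
Import numFieldNormedType.Exports.

Local Open Scope classical_set_scope.
Local Open Scope ring_scope.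

Local Notation summableZ g := (summable [set: int] (EFin \o g)).

(** * Sums over the integers *)

Section sumZ_theory.
Variable R : realType.
Implicit Types (f g p q : int -> R) (a c : R) (j k : int).

Lemma summableZ_bound f g c :
  summableZ g -> (forall k, `|f k| <= c * `|g k|) -> summableZ f.
Proof.
rewrite /summable => sg fg.
apply: (@le_lt_trans _ _ (\esum_(k in [set: int]) `|c * g k|%:E)%E).
  apply: le_esum => k _; rewrite /= lee_fin normrM (le_trans (fg k))//.
  by rewrite ler_wpM2r// ler_norm.
by apply: (le_lt_trans (esum_normZ _ _)); rewrite lte_mul_pinfty.
Qed.

Lemma summableZ_shift f j : summableZ f -> summableZ (fun k => f (k + j)).
Proof.
rewrite /summable => sf.
rewrite -(@reindex_esum _ _ _ setT setT (fun k : int => k + j)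
   (fun k => `|(EFin \o f) k|%E))//.
split=> //; first by move=> x y _ _; exact: addIr.
by move=> y _; exists (y - j) => //; rewrite subrK.
Qed.

Lemma summableZD f g : summableZ f -> summableZ g ->
  summableZ (fun k => f k + g k).
Proof. by move=> sf sg; exact: (summableD sf sg). Qed.

Lemma summableZM a f : summableZ f -> summableZ (fun k => a * f k).
Proof. by move=> sf; apply: (summableZ_bound (c := `|a|) sf) => k; rewrite normrM. Qed.

Lemma summableZN f : summableZ f -> summableZ (fun k => - f k).
Proof. by move=> sf; apply: (summableZ_bound (c := 1) sf) => k; rewrite normrN mul1r. Qed.

Lemma summableZB f g : summableZ f -> summableZ g ->
  summableZ (fun k => f k - g k).
Proof. by move=> sf sg; apply: summableZD => //; exact: summableZN. Qed.

Lemma summableZ_normr f : summableZ f -> summableZ (fun k => `|f k|).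
Proof. by move=> sf; apply: (summableZ_bound (c := 1) sf) => k; rewrite normr_id mul1r. Qed.

Lemma summableZ_esum f : summableZ f -> (forall k, 0 <= f k) ->
  \esum_(k in [set: int]) (f k)%:E \is a fin_num.
Proof.
move=> sf f0; rewrite ge0_fin_numE; last by apply: esum_ge0 => k _; rewrite lee_fin.
move: sf; rewrite /summable; congr (_ < _)%E; apply: eq_esum => k _ /=.
by rewrite ger0_norm.
Qed.

Lemma ge0_summableZ f (b : \bar R) : (forall k, 0 <= f k) -> (b < +oo)%E ->
  (\esum_(k in [set: int]) (f k)%:E <= b)%E -> summableZ f.
Proof.
move=> f0 b1 fb; rewrite /summable (eq_esum (b := fun k => (f k)%:E)).
  exact: le_lt_trans b1.
by move=> k _ /=; rewrite ger0_norm.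
Qed.

(** Any splitting into nonnegative summable functions computes [sumZ], not only the positive and
    negative parts of its definition; additivity rests on this freedom. *)
Lemma sumZ_sub p q : summableZ p -> summableZ q ->
  (forall k, 0 <= p k) -> (forall k, 0 <= q k) ->
  sumZ (fun k => p k - q k) = fine (\esum_(k in [set: int]) (p k)%:E)%E
                            - fine (\esum_(k in [set: int]) (q k)%:E)%E.
Proof.
move=> sp sq p0 q0; rewrite /sumZ.
have := esumB sp sq (fun k _ => p0 k) (fun k _ => q0 k).
rewrite -[EFin \o (fun k => p k - q k)]/((EFin \o p) \- (EFin \o q))%E => ->.
by rewrite fineB// summableZ_esum.
Qed.

Lemma sumZ_ge0E f : summableZ f -> (forall k, 0 <= f k) ->
  (sumZ f)%:E = (\esum_(k in [set: int]) (f k)%:E)%E.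
Proof.
move=> sf f0; have s0 : summableZ (fun=> 0 : R).
  by apply: (@summableZ_bound (fun=> 0) f 0 sf) => k; rewrite normr0 mul0r.
have := sumZ_sub sf s0 f0 (fun=> lexx 0).
rewrite (_ : (fun k => _) = f); last by apply/funext => k; rewrite subr0.
rewrite [X in _ - fine X]esum1//= subr0 => ->.
by rewrite fineK// summableZ_esum.
Qed.

Lemma sumZ_ge0 f : summableZ f -> (forall k, 0 <= f k) -> 0 <= sumZ f.
Proof.
move=> sf f0; rewrite -lee_fin sumZ_ge0E//.
by apply: esum_ge0 => k _; rewrite lee_fin.
Qed.

(** Positive and negative parts as real-valued closed formulas, so that the splitting
    [f = pos f - neg f] is a field identity. *)
Let pos f k := (`|f k| + f k) / 2.
Let neg f k := (`|f k| - f k) / 2.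

Let pos_ge0 f k : 0 <= pos f k.
Proof. by rewrite /pos divr_ge0// -lerBlDr sub0r -normrN ler_norm. Qed.
Let neg_ge0 f k : 0 <= neg f k.
Proof. by rewrite /neg divr_ge0// subr_ge0 ler_norm. Qed.
Let pos_neg f k : f k = pos f k - neg f k.
Proof. by rewrite /pos /neg; field. Qed.
Let pos_summable f : summableZ f -> summableZ (pos f).
Proof.
move=> sf; apply: (summableZ_bound (c := 1) sf) => k.
rewrite mul1r /pos normrM normfV (ger0_norm (ler0n _ 2)) ler_pdivrMr//.
by rewrite mulr_natr (le_trans (ler_normD _ _))// normr_id.
Qed.
Let neg_summable f : summableZ f -> summableZ (neg f).
Proof.
move=> sf; apply: (summableZ_bound (c := 1) sf) => k.
rewrite mul1r /neg normrM normfV (ger0_norm (ler0n _ 2)) ler_pdivrMr//.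
by rewrite mulr_natr (le_trans (ler_normD _ _))// normrN normr_id.
Qed.

(** The positive part of a sum is not the sum of the positive parts, but [pos f + pos g] and
    [neg f + neg g] still split [f + g], so [sumZ_sub] reduces the claim to additivity of [esum] on
    nonnegative terms. *)
Lemma sumZD f g : summableZ f -> summableZ g ->
  sumZ (fun k => f k + g k) = sumZ f + sumZ g.
Proof.
move=> sf sg.
have sub_posneg h : summableZ h -> sumZ h =
    fine (\esum_(k in [set: int]) (pos h k)%:E)%E
    - fine (\esum_(k in [set: int]) (neg h k)%:E)%E.
  move=> sh; rewrite -sumZ_sub//; [|exact: pos_summable|exact: neg_summable].
  by congr sumZ; apply/funext => k; exact: pos_neg.
rewrite (sub_posneg f)// (sub_posneg g)//.
rewrite (_ : (fun k => _) = (fun k => (pos f k + pos g k) - (neg f k + neg g k))); last first.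
  by apply/funext => k; rewrite [in LHS](pos_neg f) [in LHS](pos_neg g); ring.
have spf := pos_summable sf; have spg := pos_summable sg.
have snf := neg_summable sf; have sng := neg_summable sg.
rewrite sumZ_sub; [|exact: summableZD|exact: summableZD|by move=> k; rewrite addr_ge0..].
under eq_esum do rewrite EFinD.
under [X in _ - fine X]eq_esum do rewrite EFinD.
rewrite !esumD; [|by move=> k _; rewrite lee_fin..].
by rewrite !fineD ?summableZ_esum//; ring.
Qed.

Lemma sumZ0 : sumZ (fun=> 0 : R) = 0.
Proof.
have s0 : summableZ (fun=> 0 : R).
  by rewrite /summable esum1 ?ltry// => k _ /=; rewrite normr0.
have := sumZD s0 s0; rewrite addr0 => /eqP.
by rewrite -subr_eq0 opprD addNKr oppr_eq0 => /eqP.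
Qed.

Lemma sumZN f : summableZ f -> sumZ (fun k => - f k) = - sumZ f.
Proof.
move=> sf; apply/eqP; rewrite -addr_eq0 -sumZD//; last exact: summableZN.
by rewrite (_ : (fun k => _) = fun=> 0) ?sumZ0//; apply/funext => k; rewrite addNr.
Qed.

Lemma sumZB f g : summableZ f -> summableZ g ->
  sumZ (fun k => f k - g k) = sumZ f - sumZ g.
Proof. by move=> sf sg; rewrite sumZD ?sumZN//; exact: summableZN. Qed.

Lemma ler_sumZ f g : summableZ f -> summableZ g -> (forall k, f k <= g k) ->
  sumZ f <= sumZ g.
Proof.
move=> sf sg fg; rewrite -subr_ge0 -sumZB// sumZ_ge0//; first exact: summableZB.
by move=> k; rewrite subr_ge0.
Qed.

Lemma ler_norm_sumZ f : summableZ f -> `|sumZ f| <= sumZ (fun k => `|f k|).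
Proof.
move=> sf; have sn := summableZ_normr sf.
rewrite ler_norml -sumZN// !ler_sumZ//; [|exact: summableZN|] => k.
  by rewrite ler_norm.
by rewrite lerNl -normrN ler_norm.
Qed.

(** [esum_normZ] yields one inequality for a positive factor; the reverse one comes from applying it
    with [a^-1] to the function [a * f]. *)
Lemma ge0_sumZM a f : summableZ f -> 0 <= a -> (forall k, 0 <= f k) ->
  sumZ (fun k => a * f k) = a * sumZ f.
Proof.
move=> + a0; rewrite le_eqVlt in a0; case/predU1P: a0 => [<-|a0] sf f0.
  rewrite mul0r -[RHS]sumZ0; congr sumZ; apply/funext => k; exact: mul0r.
have leM c g : summableZ g -> 0 < c -> (forall k, 0 <= g k) ->
    sumZ (fun k => c * g k) <= c * sumZ g.
  move=> sg c0 g0; rewrite -lee_fin EFinM !sumZ_ge0E//.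
  - have := esum_normZ c g; rewrite gtr0_norm//.
    under eq_esum do rewrite ger0_norm ?mulr_ge0 ?(ltW c0)//.
    by under [in X in (_ <= X)%E -> _]eq_esum do rewrite ger0_norm//.
  - exact: summableZM.
  - by move=> k; rewrite mulr_ge0// ltW.
apply/eqP; rewrite eq_le leM//= -ler_pdivlMl//.
have := leM a^-1 (fun k => a * f k).
rewrite (_ : (fun k => a^-1 * (a * f k)) = f); last first.
  by apply/funext => k; rewrite mulKf ?gt_eqF.
apply; [exact: summableZM|by rewrite invr_gt0|by move=> k; rewrite mulr_ge0// ltW].
Qed.

Lemma sumZM a f : summableZ f -> sumZ (fun k => a * f k) = a * sumZ f.
Proof.
move=> sf; have sp := pos_summable sf; have sn := neg_summable sf.
wlog a0 : a / 0 <= a => [hw|].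
  have [|/ltW a0] := leP 0 a; first exact: hw.
  rewrite -[a]opprK mulNr -hw ?oppr_ge0// -sumZN; last exact: summableZM.
  by congr sumZ; apply/funext => k; rewrite !mulNr.
have -> : f = (fun k => pos f k - neg f k) by apply/funext => k; exact: pos_neg.
rewrite sumZB// mulrBr -!ge0_sumZM// -sumZB; [|exact: summableZM..].
by congr sumZ; apply/funext => k; rewrite mulrBr.
Qed.

Lemma sumZ_shift f j : sumZ (fun k => f (k + j)) = sumZ f.
Proof.
have bij : set_bij [set: int] [set: int] (fun k : int => k + j).
  split=> //; first by move=> x y _ _; exact: addIr.
  by move=> y _; exists (y - j) => //; rewrite subrK.
rewrite /sumZ; congr fine; congr (_ - _)%E.
  by rewrite [RHS](@reindex_esum _ _ _ _ _ _ _ bij); apply: eq_esum => k _; rewrite !funeposE.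
by rewrite [RHS](@reindex_esum _ _ _ _ _ _ _ bij); apply: eq_esum => k _; rewrite !funenegE.
Qed.

End sumZ_theory.

(** * Quadratic operators on l1 *)

Section l1_theory.
Variable R : realType.
Implicit Types (f g : l1 R) (j k : int) (c : R).

Lemma l1_summable f : summableZ f.
Proof. exact: set_mem (l1_valP f). Qed.

Lemma l1P f g : (forall k, f k = g k) -> f = g.
Proof. by move=> fg; apply/val_inj/funext. Qed.

Lemma l1D f g k : (f + g) k = f k + g k. Proof. by []. Qed.
Lemma l1N f k : (- f) k = - f k. Proof. by []. Qed.
Lemma l1B f g k : (f - g) k = f k - g k. Proof. by []. Qed.
Lemma l1Z c f k : (c *: f) k = c * f k. Proof. by []. Qed.

Lemma l1_sum (I : Type) (r : seq I) (P : pred I) (F : I -> l1 R) k :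
  (\sum_(i <- r | P i) F i) k = \sum_(i <- r | P i) F i k.
Proof.
elim: r => [|i r IH]; first by rewrite !big_nil.
by rewrite !big_cons; case: ifP => // _; rewrite l1D IH.
Qed.

Lemma l1_normE_sumZ f : `|f| = sumZ (fun k => `|f k|).
Proof.
apply: EFin_inj; rewrite sumZ_ge0E//; first exact: l1_normE.
exact/summableZ_normr/l1_summable.
Qed.

Lemma fsum_le_l1_norm f (A : set int) : finite_set A ->
  \sum_(k \in A) `|f k| <= `|f|.
Proof.
move=> finA; rewrite -lee_fin -fsumEFin//.
rewrite -[`|f|]/(l1_norm f) l1_normE; apply: ereal_sup_ubound.
by exists A.
Qed.

Lemma l1_norm_le f c :
  (forall A : set int, finite_set A -> \sum_(k \in A) `|f k| <= c) -> `|f| <= c.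
Proof.
move=> h; rewrite -lee_fin -[`|f|]/(l1_norm f) l1_normE.
by apply: ge_ereal_sup => _ [A [finA _] <-]; rewrite fsumEFin// lee_fin h.
Qed.

Lemma l1_eval_le_norm f k : `|f k| <= `|f|.
Proof.
by have := fsum_le_l1_norm f (finite_set1 k); rewrite fsbig_set1.
Qed.

Lemma l1_norm_ler f (u : int -> R) : summableZ u -> (forall k, `|f k| <= u k) ->
  `|f| <= sumZ u.
Proof.
move=> su fu; rewrite l1_normE_sumZ ler_sumZ//.
exact/summableZ_normr/l1_summable.
Qed.

Lemma massD f g : mass (f + g) = mass f + mass g.
Proof. by rewrite -sumZD//; exact: l1_summable. Qed.

Lemma massN f : mass (- f) = - mass f.
Proof. by rewrite -sumZN//; exact: l1_summable. Qed.

Lemma massZ c f : mass (c *: f) = c * mass f.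
Proof. by rewrite -sumZM//; exact: l1_summable. Qed.

Lemma mass_sum (I : Type) (r : seq I) (P : pred I) (F : I -> l1 R) :
  mass (\sum_(i <- r | P i) F i) = \sum_(i <- r | P i) mass (F i).
Proof.
elim: r => [|i r IH]; first by rewrite !big_nil [LHS]sumZ0.
by rewrite !big_cons; case: ifP => // _; rewrite massD IH.
Qed.

Lemma ge0_l1_norm f : (forall k, 0 <= f k) -> `|f| = mass f.
Proof.
by move=> f0; rewrite l1_normE_sumZ; congr sumZ; apply/funext => k; rewrite ger0_norm.
Qed.

Lemma l1_shift_subproof j f : (fun k => f (k + j)) \in @l1_pred R.
Proof. exact/mem_set/summableZ_shift/l1_summable. Qed.

Definition l1_shift j f : l1 R := L1 (l1_shift_subproof j f).

Lemma l1_shiftE j f k : l1_shift j f k = f (k + j). Proof. by []. Qed.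

Lemma mass_shift j f : mass (l1_shift j f) = mass f.
Proof. exact: (sumZ_shift f j). Qed.

Lemma norm_shift j f : `|l1_shift j f| = `|f|.
Proof. by rewrite !l1_normE_sumZ (sumZ_shift (fun k => `|f k|)). Qed.

(** * Bilinear maps on l1 with a bounded kernel *)

Section interaction.
Variables (a : int -> int -> R) (C : R).
Hypothesis aC : forall k l, `|a k l| <= C.

Lemma kernel_summable k g : summableZ (fun l => a k l * g l).
Proof.
apply: (summableZ_bound (l1_summable g)) => l.
by rewrite normrM; apply: ler_wpM2r => //; exact: aC.
Qed.

Lemma kernel_sum_le k g : `|sumZ (fun l => a k l * g l)| <= C * `|g|.
Proof.
rewrite (le_trans (ler_norm_sumZ (kernel_summable k g)))//.
have sg := summableZ_normr (l1_summable g).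
rewrite l1_normE_sumZ -sumZM// ler_sumZ//.
- exact/summableZ_normr/kernel_summable.
- exact: summableZM.
- by move=> l; rewrite normrM ler_wpM2r.
Qed.

Lemma interaction_subproof f g :
  (fun k => f k * sumZ (fun l => a k l * g l)) \in @l1_pred R.
Proof.
apply/mem_set; apply: (summableZ_bound (c := C * `|g|) (l1_summable f)) => k.
by rewrite normrM mulrC ler_wpM2r// kernel_sum_le.
Qed.

Definition interaction f g : l1 R := L1 (interaction_subproof f g).

Lemma interactionE f g k :
  interaction f g k = f k * sumZ (fun l => a k l * g l).
Proof. by []. Qed.

Lemma interactionBl f1 f2 g :
  interaction (f1 - f2) g = interaction f1 g - interaction f2 g.
Proof. by apply: l1P => k; rewrite l1B !interactionE -mulrBl. Qed.

Lemma interactionBr f g1 g2 :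
  interaction f (g1 - g2) = interaction f g1 - interaction f g2.
Proof.
apply: l1P => k; rewrite l1B !interactionE -mulrBr -sumZB; [|exact: kernel_summable..].
by congr (_ * sumZ _); apply/funext => l; rewrite l1B mulrBr.
Qed.

Lemma interactionZ c f g :
  interaction (c *: f) (c *: g) = (c * c) *: interaction f g.
Proof.
apply: l1P => k; rewrite l1Z !interactionE l1Z -!mulrA; congr (_ * _).
rewrite mulrCA; congr (_ * _); rewrite -sumZM; last exact: kernel_summable.
by congr sumZ; apply/funext => l; rewrite l1Z mulrCA.
Qed.

Lemma norm_interaction f g : `|interaction f g| <= C * `|f| * `|g|.
Proof.
rewrite mulrAC [`|f|]l1_normE_sumZ -sumZM; last exact/summableZ_normr/l1_summable.
apply: l1_norm_ler; first exact/summableZM/summableZ_normr/l1_summable.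
by move=> k; rewrite interactionE normrM mulrC ler_wpM2r// kernel_sum_le.
Qed.

(** Bilinearity: with [I] the interaction, [I(f, f) - I(g, g) = I(f - g, f) + I(g, f - g)]. *)
Lemma interaction_lipschitz f g :
  `|interaction f f - interaction g g| <= C * (`|f| + `|g|) * `|f - g|.
Proof.
have -> : interaction f f - interaction g g =
    interaction (f - g) f + interaction g (f - g).
  by rewrite interactionBl interactionBr addrA subrK.
rewrite (le_trans (ler_normD _ _))//.
rewrite (le_trans (lerD (norm_interaction _ _) (norm_interaction _ _)))//.
by rewrite le_eqVlt; apply/predU1P; left; ring.
Qed.

End interaction.
End l1_theory.

(** * The collision operator as a map from l1 to itself *)

Section collision_theory.
Variables (R : realType) (K : int -> int -> R) (C : R).
Hypothesis K_ge0 : forall k l : int, 0 <= K k l.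
Hypothesis K_le : forall k l : int, K k l <= C.
Implicit Types f g : l1 R.

Fact K_bound k l : `|K k l| <= C. Proof. by rewrite ger0_norm. Qed.
Fact K_bound_flip k l : `|K l k| <= C. Proof. exact: K_bound. Qed.

(** The two gain terms are the two terms of [loss], each moved by one site; conservation of mass is
    visible in this form. *)
Definition gain f g : l1 R :=
  l1_shift (-1) (interaction K_bound_flip f g) + l1_shift 1 (interaction K_bound f g).

Definition loss f g : l1 R := interaction K_bound f g + interaction K_bound_flip f g.

Definition collision_l1 f : l1 R := gain f f - loss f f.

Lemma collision_l1E f : collision_l1 f = collision K f :> (int -> R).
Proof.
apply/funext => k; rewrite /collision /collision2.
have sK i j u (v : int -> int -> R) : (forall k l, `|v k l| <= C) ->
    summableZ (fun l => v i (l + j) * f (l + j) * u).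
  move=> vC; apply: (@summableZ_shift _ (fun l => v i l * f l * u)).
  by under eq_fun do rewrite mulrC; exact/summableZM/(kernel_summable vC).
have sKE i j u (v : int -> int -> R) : (forall k l, `|v k l| <= C) ->
    sumZ (fun l => v i (l + j) * f (l + j) * u) = u * sumZ (fun l => v i l * f l).
  move=> vC; rewrite (sumZ_shift (fun l => v i l * f l * u)).
  rewrite -sumZM; last exact: (kernel_summable vC).
  by congr sumZ; apply/funext => l; exact: mulrC.
(* The idle [l + 0] puts all four terms into the common shape [v i (l + j) * f (l + j) * u] handled
   by [sK] and [sKE], with [j] equal to 0 or -1. *)
pose t1 l := K (l + 0) (k - 1) * f (l + 0) * f (k - 1).
pose t2 l := K k (l - 1) * f (l - 1) * f k.
pose t3 l := K (l + 0) k * f (l + 0) * f k.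
pose t4 l := K (k + 1) (l - 1) * f (l - 1) * f (k + 1).
rewrite [RHS](_ : _ = sumZ (fun l => t1 l - t2 l - t3 l + t4 l)); last first.
  by congr sumZ; apply/funext => l; rewrite /t1 /t2 /t3 /t4 addr0; ring.
have s1 : summableZ t1 := sK (k - 1) 0 (f (k - 1)) _ K_bound_flip.
have s2 : summableZ t2 := sK k (-1) (f k) _ K_bound.
have s3 : summableZ t3 := sK k 0 (f k) _ K_bound_flip.
have s4 : summableZ t4 := sK (k + 1) (-1) (f (k + 1)) _ K_bound.
rewrite (sumZD (summableZB (summableZB s1 s2) s3) s4).
rewrite (sumZB (summableZB s1 s2) s3) (sumZB s1 s2).
rewrite [sumZ t1](sKE (k - 1) 0 _ _ K_bound_flip) [sumZ t2](sKE k (-1) _ _ K_bound).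
rewrite [sumZ t3](sKE k 0 _ _ K_bound_flip) [sumZ t4](sKE (k + 1) (-1) _ _ K_bound).
rewrite l1B !l1D !l1_shiftE !interactionE; ring.
Qed.

Lemma collision_l1_lipschitz f g :
  `|collision_l1 f - collision_l1 g| <= 4 * C * (`|f| + `|g|) * `|f - g|.
Proof.
rewrite /collision_l1 /gain /loss.
set I := interaction K_bound; set J := interaction K_bound_flip.
have -> : l1_shift (-1) (J f f) + l1_shift 1 (I f f) - (I f f + J f f) -
   (l1_shift (-1) (J g g) + l1_shift 1 (I g g) - (I g g + J g g)) =
   l1_shift (-1) (J f f - J g g) + l1_shift 1 (I f f - I g g)
   - ((I f f - I g g) + (J f f - J g g)).
  by apply: l1P => k; rewrite !(l1B, l1D, l1N, l1_shiftE); ring.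
rewrite (le_trans (ler_normB _ _))// (le_trans (lerD (ler_normD _ _) (ler_normD _ _)))//.
rewrite !norm_shift.
have HI := interaction_lipschitz K_bound f g.
have HJ := interaction_lipschitz K_bound_flip f g.
rewrite (le_trans (lerD (lerD HJ HI) (lerD HI HJ)))//.
by rewrite le_eqVlt; apply/predU1P; left; ring.
Qed.

(* Adding [2 C m(g) f] to the collision operator makes all the coefficients
   of the quadratic form nonnegative. *)
Definition boosted f g : l1 R := gain f g - loss f g + (2 * C * mass g) *: f.

Lemma boosted_diag f : boosted f f = collision_l1 f + (2 * C * mass f) *: f.
Proof. by []. Qed.

Lemma boostedZ c f g : boosted (c *: f) (c *: g) = (c * c) *: boosted f g.
Proof.
rewrite /boosted /gain /loss !interactionZ massZ.
by apply: l1P => k; rewrite !(l1D, l1N, l1B, l1Z, l1_shiftE); ring.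
Qed.

(** The boost absorbs both loss terms into the single weight [2 * C - K k l - K l k]; the factor 2
    is there because two kernel values, each at most [C], are subtracted. *)
Lemma boostedE f g k : boosted f g k =
    f (k - 1) * sumZ (fun l => K l (k - 1) * g l)
  + f (k + 1) * sumZ (fun l => K (k + 1) l * g l)
  + f k * sumZ (fun l => (2 * C - K k l - K l k) * g l).
Proof.
rewrite l1D l1B !l1D !l1_shiftE !interactionE l1Z.
rewrite (_ : (fun l => (2 * C - K k l - K l k) * g l) =
    (fun l => 2 * C * g l - K k l * g l - K l k * g l)); last first.
  by apply/funext => l; ring.
have sg := l1_summable g.
have s1 := kernel_summable K_bound k g.
have s2 := kernel_summable K_bound_flip k g.
have s3 := summableZM (2 * C) sg.
rewrite !sumZB//; last exact: summableZB.
by rewrite sumZM// /mass; ring.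
Qed.

Lemma boosted_ge0 f g : (forall k, 0 <= f k) -> (forall k, 0 <= g k) ->
  forall k, 0 <= boosted f g k.
Proof.
move=> f0 g0 k; rewrite boostedE.
have H (a : int -> int -> R) c i : (forall k l, `|a k l| <= c) ->
    (forall k l, 0 <= a k l) -> 0 <= sumZ (fun l => a i l * g l).
  move=> ac a0; apply: sumZ_ge0; first exact: (kernel_summable ac).
  by move=> l; rewrite mulr_ge0.
have cb i l : 0 <= 2 * C - K i l - K l i.
  by have := K_le i l; have := K_le l i; lra.
have cB i l : `|2 * C - K i l - K l i| <= 2 * C.
  by rewrite ger0_norm//; have := K_ge0 i l; have := K_ge0 l i; lra.
rewrite !addr_ge0// mulr_ge0//.
- exact: (H _ _ _ K_bound_flip).
- exact: (H _ _ _ K_bound).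
- exact: (H _ _ _ cB).
Qed.

(** Shifts preserve mass, so gain and loss cancel and only the boost contributes. *)
Lemma mass_boosted f g : mass (boosted f g) = 2 * C * mass f * mass g.
Proof.
rewrite massD massZ massD massN !massD !mass_shift [X in - X]addrC subrr add0r.
by rewrite mulrAC.
Qed.

End collision_theory.

(** * Differential inequalities in l1 *)

Section calculus_l1.
Variable R : realType.
Implicit Types (h d : R -> l1 R) (k : int) (a b s t : R).

Lemma is_derive_sum_seq (I : Type) (r : seq I) (F : I -> R -> R) (dF : I -> R) s :
  (forall i, is_derive s 1 (F i) (dF i)) ->
  is_derive s 1 (fun x => \sum_(i <- r) F i x) (\sum_(i <- r) dF i).
Proof.
move=> FdF; elim: r => [|i r IH].
  rewrite big_nil (_ : (fun x => _) = cst 0); first exact: is_derive_cst.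
  by apply/funext => x; rewrite big_nil.
rewrite big_cons (_ : (fun x => _) = F i + (fun x => \sum_(i <- r) F i x)).
  exact: is_deriveD.
by apply/funext => x; rewrite big_cons.
Qed.

Lemma within_continuous_sum_seq (I : Type) (r : seq I) (A : set R) (F : I -> R -> R) :
  (forall i, {within A, continuous (F i)}) ->
  {within A, continuous (fun x => \sum_(i <- r) F i x)}.
Proof.
move=> cF; elim: r => [|i r IH].
  rewrite (_ : (fun x => _) = cst 0); first by move=> x; exact: cst_continuous.
  by apply/funext => x; rewrite big_nil.
rewrite (_ : (fun x => _) = F i + (fun x => \sum_(i <- r) F i x)).
  by move=> x; apply: continuousD; [exact: cF|exact: IH].
by apply/funext => x; rewrite big_cons.
Qed.

(* Test the increment of [h] against finitely supported sign sequences. *)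
Lemma l1_mean_value h d (rho drho : R -> R) a b : a <= b ->
  (forall k, {within `[a, b], continuous (fun s => h s k)}) ->
  {within `[a, b], continuous rho} ->
  (forall k s, s \in `]a, b[ -> is_derive s 1 (fun x => h x k) (d s k)) ->
  (forall s, s \in `]a, b[ -> is_derive s 1 rho (drho s)) ->
  (forall s, s \in `]a, b[ -> `|d s| <= drho s) ->
  `|h b - h a| <= rho b - rho a.
Proof.
rewrite le_eqVlt => /predU1P[<- *|ab ch crho hd rhod drhoP].
  by rewrite !subrr normr0.
apply: l1_norm_le => A finA.
have [r rE] : exists r : seq int, forall u : int -> R,
    \sum_(k \in A) u k = \sum_(k <- r) u k.
  by eexists => u; rewrite fsbig_finite.
rewrite rE.
pose e k := Num.sg (h b k - h a k).
pose F k s := e k * h s k; pose phi := (fun s => \sum_(k <- r) F k s) - rho.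
have dphi s : s \in `]a, b[ ->
    is_derive s 1 phi (\sum_(k <- r) e k * d s k - drho s).
  move=> sab; apply: is_deriveB; last exact: rhod.
  apply: is_derive_sum_seq => k.
  have := @is_deriveZ R R^o R^o _ (e k) s 1 _ (hd k s sab); exact.
have cphi : {within `[a, b], continuous phi}.
  move=> x; apply: continuousB; last exact: crho.
  apply: within_continuous_sum_seq => k y.
  by apply: cvgM; [exact: cvg_cst|exact: ch].
have [s sab phiE] := MVT ab dphi cphi.
have phiV (x : R) : phi x = \sum_(k <- r) F k x - rho x by [].
(* The signs [e k] were taken from the increment itself, so testing recovers its absolute values. It
   remains to see that [phi] does not increase, that is, that its derivative is nonpositive. *)
have -> : \sum_(k <- r) `|(h b - h a) k| = phi b - phi a + (rho b - rho a).
  transitivity (\sum_(k <- r) F k b - \sum_(k <- r) F k a); last by rewrite !phiV; ring.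
  by rewrite -sumrB; apply: eq_bigr => k _; rewrite /F /e -mulrBr -normrEsg.
rewrite gerDr phiE; apply: mulr_le0_ge0; last by rewrite subr_ge0 ltW.
rewrite subr_le0 (le_trans _ (drhoP s sab))//.
apply: (@le_trans _ _ (\sum_(k <- r) `|d s k|)).
  apply: ler_sum => k _; rewrite (le_trans (ler_norm _))// normrM.
  by rewrite -[leRHS]mul1r ler_wpM2r// /e normr_sg; case: (_ != 0).
by rewrite -rE fsum_le_l1_norm.
Qed.

(* The mean value inequality with [rho] a multiple of [expR (2 L s)] halves any
   bound of the form [|h s| <= c expR (2 L s)]. *)
Lemma l1_gronwall h d (L D T : R) : 0 < L ->
  h 0 = 0 ->
  (forall k, {within `[0, T], continuous (fun s => h s k)}) ->
  (forall k s, s \in `]0, T[ -> is_derive s 1 (fun x => h x k) (d s k)) ->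
  (forall s, s \in `]0, T[ -> `|d s| <= L * `|h s|) ->
  (forall s, s \in `[0, T] -> `|h s| <= D) ->
  forall s, s \in `[0, T] -> h s = 0.
Proof.
move=> L0 h0 ch hd dL hD.
have iter n : forall s, s \in `[0, T] -> `|h s| <= D / 2 ^+ n * expR (2 * L * s).
  elim: n => [|n IH] s sT.
    move: (sT); rewrite in_itv/= => /andP[s0 _].
    rewrite expr0 divr1 (le_trans (hD s sT))// ler_peMr//.
      exact: le_trans (hD s sT).
    by rewrite -expR0 ler_expR mulr_ge0// mulr_ge0// ltW.
  move: (sT); rewrite in_itv/= => /andP[s0 sT'].
  pose drho (x : R) := L * (D / 2 ^+ n * expR (2 * L * x)).
  have [rho rhoE rhod] : exists2 rho : R -> R,
      forall x, rho x = D / 2 ^+ n.+1 * expR (2 * L * x) &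
      forall x : R, is_derive x 1 rho (drho x).
    exists (fun x => D / 2 ^+ n.+1 * expR (2 * L * x)) => // x.
    have H1 : is_derive x 1 ((2 * L) \*: (id : R -> R)) (2 * L *: 1).
      exact: is_deriveZ.
    have H2 := is_derive1_comp (is_derive_expR (((2 * L) \*: (id : R -> R)) x)) H1.
    have H3 := @is_deriveZ R R^o R^o _ (D / 2 ^+ n.+1) x 1 _ H2.
    apply: (is_derive_eq H3); rewrite /= exprS invfM /drho /GRing.scale /=.
    by field; rewrite expf_eq0 pnatr_eq0 andbF.
  have sub x : x \in `]0, s[ -> x \in `]0, T[.
    by rewrite !in_itv/= => /andP[-> xs]; rewrite (lt_le_trans xs).
  suff H : `|h s - h 0| <= rho s - rho 0.
    rewrite h0 subr0 in H; apply: le_trans H _.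
    rewrite !rhoE gerBl mulr_ge0 ?expR_ge0// divr_ge0 ?exprn_ge0//.
    exact: le_trans (hD s sT).
  have ch' k : {within `[0, s], continuous (fun x => h x k)}.
    apply: continuous_subspaceW (ch k) => x /=.
    by rewrite !in_itv/= => /andP[-> xs]; rewrite (le_trans xs).
  have crho : {within `[0, s], continuous rho}.
    apply: derivable_within_continuous => x _.
    by have := rhod x => ?; exact: ex_derive.
  have dle x : x \in `]0, s[ -> `|d x| <= drho x.
    move=> /sub xT; rewrite (le_trans (dL x xT))// ler_pM2l// IH//.
    by move: xT; rewrite !in_itv/= => /andP[/ltW-> /ltW->].
  exact: (l1_mean_value s0 ch' crho (fun k x xs => hd k x (sub x xs))
    (fun x _ => rhod x) dle).
move=> s sT; apply/normr0_eq0/eqP; rewrite eq_le normr_ge0 andbT.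
apply/ler_addgt0Pl => e e0; rewrite addr0.
set B := D * expR (2 * L * s).
have B0 : 0 <= B by rewrite mulr_ge0 ?expR_ge0// (le_trans _ (hD s sT)).
(* An Archimedean [n] above [B / e] is enough, since [n < 2 ^ n]. *)
have nB := archi_boundP (divr_ge0 B0 (ltW e0)); set n := Num.bound (B / e) in nB.
rewrite (le_trans (iter n s sT))// mulrAC -/B.
rewrite ler_pdivrMr ?exprn_gt0// [e * _]mulrC -ler_pdivrMr//.
by rewrite (le_trans (ltW nB))// -natrX ler_nat ltnW// ltn_expl.
Qed.

End calculus_l1.

(** * Regularity and uniqueness of solutions *)

Section solutions.
Variables (R : realType) (K : int -> int -> R) (C : R).
Hypothesis K_ge0 : forall k l : int, 0 <= K k l.
Hypothesis K_le : forall k l : int, K k l <= C.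
Local Notation Q := (collision_l1 K_ge0 K_le).

Lemma collision_l1_0 : Q 0 = 0.
Proof.
by apply: l1P => k; rewrite l1B !l1D !l1_shiftE !interactionE !mul0r !addr0 subr0.
Qed.

Lemma norm_collision_l1 f : `|Q f| <= 4 * C * `|f| ^+ 2.
Proof.
have := collision_l1_lipschitz K_ge0 K_le f 0.
by rewrite collision_l1_0 !subr0 normr0 addr0 expr2 mulrA.
Qed.

Lemma l1_eval_continuous k : continuous (fun f : l1 R => f k).
Proof.
move=> f; apply/(@cvgrPdist_lt R R^o (l1 R) (nbhs f)) => e e0; near=> g.
by rewrite (le_lt_trans (l1_eval_le_norm (f - g) k))//; near: g; exact: cvgr_dist_lt.
Unshelve. all: by end_near. Qed.

Lemma is_derive_l1_eval (u : R -> l1 R) (s : R) (du : l1 R) k :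
  is_derive s 1 u du -> is_derive s 1 (fun x => u x k) (du k).
Proof.
move=> [+ <-]; rewrite /derivable /derive.
set q := (fun h => h^-1 *: ((u \o shift s) (h *: 1) - u s)) => uq.
have H : (fun h => h^-1 *: (((fun x => u x k) \o shift s) (h *: 1) - u s k)) @ 0^'
    --> (lim (q @ 0^')) k.
  have -> : (fun h => h^-1 *: (((fun x => u x k) \o shift s) (h *: 1) - u s k)) =
      (fun h : R => q h k) by [].
  exact: (cvg_comp q (fun g : l1 R => g k) uq (@l1_eval_continuous k _)).
by split; [apply/cvg_ex; eexists; exact: H|exact: cvg_lim].
Qed.

(** Dividing the remainder by [h] leaves an error of at most [L * |h|]. This turns a Taylor estimate
    into differentiability in norm. *)
Lemma is_derive_quadratic (V : normedModType R) (f : R -> V) (t : R) (v : V) (L e : R) :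
  0 < e -> 0 <= L ->
  (forall h, `|h| < e -> `|f (h + t) - f t - h *: v| <= L * h ^+ 2) ->
  is_derive t 1 f v.
Proof.
move=> e0 L0 fP.
have H : (fun h => h^-1 *: ((f \o shift t) (h *: 1) - f t)) @ 0^' --> v.
  apply/cvgrPdist_le => eps eps0; near=> h.
  have h0 : h != 0 by near: h; exact: nbhs_dnbhs_neq.
  have he : `|h| < e by near: h; exact: dnbhs0_lt.
  have -> : v - h^-1 *: ((f \o shift t) (h *: 1) - f t) =
      - (h^-1 *: (f (h + t) - f t - h *: v)).
    by rewrite /= [h%:A]mulr1 [in RHS]scalerBr scalerA mulVf// scale1r opprB.
  rewrite normrN normrZ normfV ler_pdivrMl ?normr_gt0//.
  rewrite (le_trans (fP h he))// -real_normK ?num_real// expr2 mulrCA ler_wpM2l//.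
  (* The [+ 1] keeps the denominator positive when [L = 0]. *)
  have : `|h| < eps / (L + 1).
    by near: h; apply: dnbhs0_lt; rewrite divr_gt0// ltr_wpDl.
  rewrite ltr_pdivlMr ?ltr_wpDl// => /ltW; apply: le_trans.
  by rewrite mulrC ler_wpM2l// lerDl.
by split; [apply/cvg_ex; exists v|exact: cvg_lim].
Unshelve. all: by end_near. Qed.

Lemma lipschitz_within_continuous (V : normedModType R) (f : R -> V) (A : set R) (L : R) :
  0 <= L -> (forall x y, A x -> A y -> `|f y - f x| <= L * `|y - x|) ->
  {within A, continuous f}.
Proof.
move=> L0 fL; apply/subspace_continuousP => x Ax; apply/cvgrPdist_le => e e0.
rewrite near_withinE; near=> y => Ay; rewrite distrC (le_trans (fL _ _ Ax Ay))//.
have : `|x - y| < e / (L + 1).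
  by near: y; apply: cvgr_dist_lt; rewrite ?divr_gt0 ?ltr_wpDl.
rewrite distrC ltr_pdivlMr ?ltr_wpDl// => /ltW; apply: le_trans.
by rewrite mulrC ler_wpM2l// lerDl.
Unshelve. all: by end_near. Qed.

(** * From bounded coordinatewise solutions to solutions in norm *)

Section weak_to_strong.
Variables (f : R -> l1 R) (M : R).
Hypothesis f_le : forall t, 0 <= t -> `|f t| <= M.
Hypothesis f_cont : forall (k : int) (b : R),
  {within `[0, b], continuous (fun s => f s k)}.
Hypothesis f_der : forall (k : int) (s : R), 0 < s ->
  is_derive s 1 (fun x => f x k) (Q (f s) k).

Let C0 : 0 <= C. Proof. exact: le_trans (K_ge0 0 0) (K_le 0 0). Qed.
Let M0 : 0 <= M. Proof. by rewrite (le_trans _ (f_le (lexx 0))). Qed.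
(** [Lf] bounds the norm of [Q (f t)], hence is a Lipschitz constant of [f]; [LQ] is then one of
    [Q \o f], because [Q] is Lipschitz on the ball of radius [M]. *)
Let Lf := 4 * C * M ^+ 2.
Let LQ := 4 * C * (M + M) * Lf.
Let Lf_ge0 : 0 <= Lf. Proof. by rewrite !mulr_ge0// exprn_ge0. Qed.
Let LQ_ge0 : 0 <= LQ. Proof. by rewrite !mulr_ge0// addr_ge0. Qed.

Let f_contW k (a b : R) : 0 <= a -> {within `[a, b], continuous (fun s => f s k)}.
Proof.
move=> a0; apply: continuous_subspaceW (@f_cont k b) => x /=.
by rewrite !in_itv/= => /andP[ax ->]; rewrite (le_trans a0).
Qed.

Let is_derive_linear (c s : R) : is_derive s 1 (fun x : R => c * x) c.
Proof.
apply: (is_derive_eq (@is_deriveZ R R^o R^o id c s 1 1 _)).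
by rewrite /GRing.scale/= mulr1.
Qed.

Let continuous_linear (c : R) (A : set R) : {within A, continuous (fun x : R => c * x)}.
Proof.
apply: continuous_subspaceT => x.
by apply: cvgM; [exact: cvg_cst|exact: cvg_id].
Qed.

Let lip (a b : R) : 0 <= a -> a <= b -> `|f b - f a| <= Lf * (b - a).
Proof.
move=> a0 ab; rewrite mulrBr.
apply: (@l1_mean_value _ f (Q \o f) (fun x => Lf * x) (fun=> Lf)) => //.
- by move=> k; exact: f_contW.
- by move=> k s; rewrite in_itv/= => /andP[as_ _]; apply: f_der; exact: le_lt_trans as_.
- move=> s; rewrite in_itv/= => /andP[as_ _]; rewrite (le_trans (norm_collision_l1 _))//.
  rewrite ler_wpM2l ?mulr_ge0//.
  by rewrite lerXn2r ?nnegrE// f_le// (le_trans a0)// ltW.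
Qed.

Let lipC (a b : R) : 0 <= a -> 0 <= b -> `|f b - f a| <= Lf * `|b - a|.
Proof.
move=> a0 b0; have [ab|/ltW ba] := leP a b.
  by rewrite (@ger0_norm _ (b - a)) ?subr_ge0// lip.
by rewrite distrC (@distrC _ _ b) (@ger0_norm _ (a - b)) ?subr_ge0// lip.
Qed.

Let lipQ (a b : R) : 0 <= a -> 0 <= b -> `|Q (f b) - Q (f a)| <= LQ * `|b - a|.
Proof.
move=> a0 b0; rewrite (le_trans (collision_l1_lipschitz _ _ _ _))//.
rewrite -[leRHS]mulrA ler_pM ?mulr_ge0 ?addr_ge0 ?lipC//.
by rewrite ler_wpM2l ?mulr_ge0// lerD ?f_le.
Qed.

(** Mean value inequality for [f s - s *: Q (f c)], whose coordinatewise derivative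
    [Q (f s) - Q (f c)] has norm at most [LQ * (b - a)]. The free base point [c] serves increments
    to the right ([c = a]) and to the left ([c = b]). *)
Let taylor (a b c : R) : 0 <= a -> a <= c -> c <= b ->
  `|f b - f a - (b - a) *: Q (f c)| <= LQ * (b - a) ^+ 2.
Proof.
move=> a0 ac cb; have c0 := le_trans a0 ac; have ab := le_trans ac cb.
have -> : f b - f a - (b - a) *: Q (f c) =
    (f b - b *: Q (f c)) - (f a - a *: Q (f c)).
  by apply: l1P => k; rewrite !(l1B, l1Z); ring.
have -> : LQ * (b - a) ^+ 2 = LQ * (b - a) * b - LQ * (b - a) * a by ring.
have E k : (fun s => (f s - s *: Q (f c)) k) =
    (fun s => f s k) - (fun s : R => Q (f c) k * s).
  by apply/funext => s; rewrite l1B l1Z mulrC.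
apply: (@l1_mean_value _ (fun s => f s - s *: Q (f c)) (fun s => Q (f s) - Q (f c))
  (fun x => LQ * (b - a) * x) (fun=> LQ * (b - a))) => //.
- move=> k; rewrite E => x; apply: continuousB; first exact: f_contW.
  exact: continuous_linear.
- move=> k s; rewrite in_itv/= => /andP[as_ _].
  rewrite E; apply: is_deriveB; last exact: is_derive_linear.
  by apply: f_der; exact: le_lt_trans as_.
- move=> s; rewrite in_itv/= => /andP[as_ sb].
  rewrite (le_trans (lipQ _ _))//; first by rewrite (le_trans a0)// ltW.
  by rewrite ler_wpM2l// ler_norml; lra.
Qed.

Let weak_der (t : R) : 0 < t -> is_derive t 1 f (Q (f t)).
Proof.
(* The radius [t] keeps [h + t] nonnegative, where the estimates on [f] hold. *)
move=> t0; apply: (@is_derive_quadratic _ _ _ _ LQ t) => // h ht.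
have [h0|/ltW h0] := leP 0 h.
  have := @taylor t (h + t) t (ltW t0) (lexx _).
  by rewrite addrK; apply; rewrite lerDr.
have ht0 : 0 <= h + t.
  by have : - h <= `|h| by [rewrite -normrN ler_norm]; lra.
have htt : h + t <= t by rewrite gerDr.
have := taylor ht0 htt (lexx t).
rewrite (_ : t - (h + t) = - h); last by ring.
rewrite sqrrN -normrN; apply: le_trans.
rewrite le_eqVlt; apply/predU1P; left; congr (`|_|).
by apply: l1P => k; rewrite !(l1B, l1D, l1N, l1Z); ring.
Qed.

Lemma weak_solution_C1 : C1_on +oo%E f.
Proof.
exists (Q \o f); split.
- apply: (lipschitz_within_continuous LQ_ge0) => x y [x0 _] [y0 _].
  exact: lipQ.
- by move=> t t0 _; exact: weak_der.
- apply/cvgrPdist_le => eps eps0; near=> h.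
  have h0 : 0 < h by near: h; exact: nbhs_right_gt.
  have := @taylor 0 h 0 (lexx _) (lexx _) (ltW h0); rewrite subr0 => H.
  have -> : Q (f 0) - h^-1 *: (f h - f 0) = - (h^-1 *: (f h - f 0 - h *: Q (f 0))).
    by rewrite [in RHS]scalerBr scalerA mulVf ?gt_eqF// scale1r opprB.
  rewrite normrN normrZ gtr0_norm ?invr_gt0// ler_pdivrMl//.
  rewrite (le_trans H)// expr2 mulrCA ler_pM2l//.
  have : h < eps / (LQ + 1).
    by near: h; apply: nbhs_right_lt; rewrite divr_gt0// ltr_wpDl.
  rewrite ltr_pdivlMr ?ltr_wpDl// => /ltW; apply: le_trans.
  by rewrite mulrC ler_wpM2l ?(ltW h0)// lerDl.
Unshelve. all: by end_near. Qed.


Lemma weak_solution_is_solution : is_solution K (f 0) +oo%E f.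
Proof.
have C1 := weak_solution_C1.
split => // t t0 _; rewrite -(collision_l1E K_ge0 K_le).
by rewrite derive1E; have := weak_der t0 => ?; rewrite derive_val.
Qed.

End weak_to_strong.

(** * Uniqueness on a common interval of existence *)

Section uniqueness.
Variables (f g : R -> l1 R) (S : \bar R).
Hypothesis solf : is_solution K (f 0) S f.
Hypothesis solg : is_solution K (f 0) S g.

Let sol_der (u : R -> l1 R) (t : R) : is_solution K (f 0) S u -> 0 < t -> (t%:E < S)%E ->
  is_derive t 1 u (Q (u t)).
Proof.
move=> [_ [du [_ uD _] _ uQ] t0 tS].
apply: (is_derive_eq (uD t t0 tS)); apply: val_inj.
rewrite [RHS]collision_l1E -uQ// derive1E.
by have := uD t t0 tS => ?; rewrite derive_val.
Qed.

Let sol_cont (u : R -> l1 R) (t : R) : is_solution K (f 0) S u -> 0 < t -> (t%:E < S)%E ->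
  {within `[0, t], continuous u}.
Proof.
move=> solu t0 tS.
have cu s : 0 < s -> (s%:E < S)%E -> {for s, continuous u}.
  move=> s0 sS; apply: differentiable_continuous; apply/derivable1_diffP.
  by have := sol_der solu s0 sS => ?; exact: ex_derive.
apply/continuous_within_itvP => //; split.
- move=> s; rewrite in_itv/= => /andP[s0 st]; apply: cu => //.
  by rewrite (lt_trans _ tS)// lte_fin.
- case: solu => _ [du [_ _ du0]] _ _.
  (* At 0 only the one-sided difference quotient is available: [u h] is [u 0] plus [h] times a
     quotient tending to [du 0], so it tends to [u 0]. *)
  rewrite -[X in _ --> X]addr0 -[X in _ + X](scale0r (du 0)).
  have H : (fun h => u 0 + h *: (h^-1 *: (u h - u 0))) @ 0^'+ --> u 0 + 0 *: du 0.
    apply: cvgD; first exact: cvg_cst.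
    by apply: cvgZ => //; apply: cvg_at_right_filter; exact: cvg_id.
  apply: cvg_trans H; apply: near_eq_cvg; near=> h.
  have h0 : 0 < h by near: h; exact: nbhs_right_gt.
  by rewrite scalerA mulfV ?gt_eqF// scale1r addrC subrK.
- by apply: cvg_at_left_filter; exact: cu.
Unshelve. all: by end_near. Qed.

(** Compactness of [[0, t]] bounds both solutions, and [Q] is Lipschitz on bounded sets, so the
    difference satisfies the hypotheses of [l1_gronwall]. *)
Lemma solution_unique (t : R) : 0 <= t -> (t%:E < S)%E -> g t = f t.
Proof.
rewrite le_eqVlt => /predU1P[<- _|t0 tS]; first by case: solg.
have [cf cg] := (sol_cont solf t0 tS, sol_cont solg t0 tS).
have bound (u : R -> l1 R) : {within `[0, t], continuous u} ->
    exists M, forall s, s \in `[0, t] -> `|u s| <= M.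
  move=> cu; have [c _ cM] := EVT_max (ltW t0) (fun x => cvg_norm (cu x)).
  by exists `|u c|.
have [Mf fM] := bound f cf; have [Mg gM] := bound g cg.
have C0 : 0 <= C by exact: le_trans (K_ge0 0 0) (K_le 0 0).
have in0 : 0 \in `[0, t] by rewrite in_itv/= lexx ltW.
have Mf0 : 0 <= Mf by rewrite (le_trans _ (fM 0 _)).
have Mg0 : 0 <= Mg by rewrite (le_trans _ (gM 0 _)).
have evalc k (u : R -> l1 R) : {within `[0, t], continuous u} ->
    {within `[0, t], continuous (fun s => u s k)}.
  by move=> cu x; exact: (cvg_comp u (fun g : l1 R => g k) (cu x) (@l1_eval_continuous k _)).
(* The [+ 1] makes the Lipschitz constant strictly positive, as [l1_gronwall] requires, even if both
   bounds vanish. *)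
have L0 : 0 < 4 * C * (Mg + Mf) + 1.
  by rewrite ltr_wpDl// !mulr_ge0// addr_ge0.
have sub s : s \in `]0, t[ -> [/\ s \in `[0, t], 0 < s & (s%:E < S)%E].
  rewrite !in_itv/= => /andP[s0 st]; split => //; first by rewrite !ltW.
  by rewrite (lt_trans _ tS)// lte_fin.
apply/eqP; rewrite -subr_eq0; apply/eqP.
apply: (@l1_gronwall _ (fun s => g s - f s) (fun s => Q (g s) - Q (f s)) _ (Mg + Mf) t L0).
- by case: solg => _ _ -> _; rewrite subrr.
- by move=> k x; apply: continuousB; [exact: evalc cg x|exact: evalc cf x].
- move=> k s /sub[_ s0 sS]; rewrite l1B.
  by apply: is_deriveB; apply: is_derive_l1_eval; exact: sol_der.
- move=> s /sub[st _ _]; rewrite (le_trans (collision_l1_lipschitz _ _ _ _))//.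
  rewrite ler_wpM2r// (@le_trans _ _ (4 * C * (Mg + Mf)))// ?lerDl//.
  by rewrite ler_wpM2l ?mulr_ge0//; apply: lerD; [exact: gM|exact: fM].
- by move=> s st; apply: le_trans (ler_normB _ _) (lerD _ _); [exact: gM|exact: fM].
- by rewrite in_itv/= lexx ltW.
Qed.

End uniqueness.
End solutions.

(** * Power series *)

Section power_series.
Variable R : realType.
Implicit Types (b c : R^nat) (x z q M : R).

Lemma cvg_pseries_bounded c M x : (forall n, `|c n| <= M) -> `|x| < 1 ->
  cvgn (pseries c x).
Proof.
move=> cM x1; apply: normed_cvg.
apply: (@series_le_cvg _ _ (geometric M `|x|)) => //.
- by move=> n /=.
- by move=> n /=; rewrite mulr_ge0 ?exprn_ge0 ?(le_trans _ (cM 0%N)).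
- by move=> n /=; rewrite normrM normrX ler_wpM2r ?exprn_ge0.
- by apply: is_cvg_geometric_series; rewrite normr_id.
Qed.

(** The partial sums increase, and an exact formula for their product with [(1 - q) ^+ 2] shows that
    this product is at most 1. *)
Lemma cvg_arith_geometric_series q : 0 <= q -> q < 1 ->
  cvgn (series (fun n => n.+1%:R * q ^+ n)).
Proof.
move=> q0 q1; apply: nondecreasing_is_cvgn.
  by apply: nondecreasing_series => n _ _; rewrite mulr_ge0 ?exprn_ge0.
exists ((1 - q) ^- 2) => _ [n _ <-].
rewrite -[leRHS]mul1r ler_pdivlMr ?exprn_gt0 ?subr_gt0//.
have -> : series (fun n => n.+1%:R * q ^+ n) n * (1 - q) ^+ 2 =
    1 - q ^+ n * (1 + n%:R * (1 - q)).
  elim: n => [|n IH]; first by rewrite /series/= big_nil expr0; ring.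
  by rewrite seriesSr mulrDl IH [q ^+ n.+1]exprS -natr1; ring.
by rewrite gerBl mulr_ge0 ?exprn_ge0// addr_ge0// mulr_ge0// subr_ge0 ltW.
Qed.

(** Fix [r] strictly between [|x|] and 1. The terms [c n * r ^+ n] are bounded by some [M], so the
    differentiated series is dominated by a multiple of the series of [n.+1%:R * q ^+ n] with
    [q = |x| / r < 1]. *)
Lemma cvg_pseries_diffs c : (forall x, `|x| < 1 -> cvgn (pseries c x)) ->
  forall x, `|x| < 1 -> cvgn (pseries (pseries_diffs c) x).
Proof.
move=> cc x x1.
have [r [r0 r1 xr]] : exists r, [/\ 0 < r, `|r| < 1 & `|x| / r < 1].
  have x0 : 0 <= `|x| by [].
  exists ((1 + `|x|) / 2); split; first by lra.
    by rewrite ger0_norm; lra.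
  by rewrite ltr_pdivrMr; lra.
have [M Mc] : exists M, forall n, `|c n * r ^+ n| <= M.
  have /cvg_series_cvg_0/cvg_norm/cvgP/cvg_seq_bounded := cc r r1.
  by move=> /bounded_fun_has_ubound[M MP]; exists M => n; apply: MP; exists n.
apply: normed_cvg.
apply: (@series_le_cvg _ _ (fun n => M / r * (n.+1%:R * (`|x| / r) ^+ n))).
- by move=> n /=.
- move=> n; apply: mulr_ge0; first by rewrite divr_ge0 ?(ltW r0)// (le_trans _ (Mc 0%N)).
  by rewrite mulr_ge0// exprn_ge0// divr_ge0// ltW.
- move=> n; rewrite /pseries_diffs /= !normrM normr_nat normrX -mulrA.
  rewrite [leRHS](_ : _ = n.+1%:R * (M * `|x| ^+ n / r ^+ n.+1)); last first.
    by rewrite expr_div_n exprS invfM; ring.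
  rewrite ler_wpM2l// ler_pdivlMr ?exprn_gt0// mulrAC ler_wpM2r ?exprn_ge0//.
  by have := Mc n.+1; rewrite normrM [`|r ^+ _|]ger0_norm// exprn_ge0// ltW.
- apply: (@is_cvg_seriesZ R _ (M / r)); apply: cvg_arith_geometric_series => //.
  by rewrite divr_ge0// ltW.
Qed.

(** [pseries_snd_diffs] asks for convergence of the series and of its first two formal derivatives
    at a radius beyond [|x|]. The midpoint of [|x|] and 1 serves, as formal differentiation
    preserves convergence on the unit disc. *)
Lemma is_derive_pseries c M x : (forall n, `|c n| <= M) -> `|x| < 1 ->
  is_derive x 1 (fun y => limn (pseries c y)) (limn (pseries (pseries_diffs c) x)).
Proof.
move=> cM x1; have c0 y := @cvg_pseries_bounded c M y cM.
have c1 := cvg_pseries_diffs c0; have c2 := cvg_pseries_diffs c1.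
pose r := (1 + `|x|) / 2; have x0 : 0 <= `|x| by [].
have r0 : 0 <= r by rewrite /r; lra.
have r1 : `|r| < 1 by rewrite ger0_norm// /r; lra.
apply: (@pseries_snd_diffs _ c r x); [exact: c0|exact: c1|exact: c2|].
by rewrite (ger0_norm r0) /r; lra.
Qed.

Lemma lim_pseries0 c : limn (pseries c 0) = c 0%N.
Proof.
apply: cvg_lim => //; apply: cvg_near_cst; exists 1%N => // -[|n] // _.
rewrite /pseries seriesEnat/= big_nat_recl// expr0 mulr1 big1 ?addr0// => i _.
by rewrite expr0n mulr0.
Qed.

(** With nonnegative terms, triangles and squares of indices nest: the triangular sum [P N] is at
    most the product of the [N]-th partial sums, which is at most [P (N + N)]. *)
Lemma cvg_cauchy_product (x y : R^nat) :
  (forall n, 0 <= x n) -> (forall n, 0 <= y n) ->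
  cvgn (series x) -> cvgn (series y) ->
  series (fun n => \sum_(i < n.+1) x i * y (n - i)%N) @ \oo -->
    limn (series x) * limn (series y).
Proof.
move=> x0 y0 cx cy.
set P := series _.
have ndx : nondecreasing_seq (series x) by apply: nondecreasing_series => n _ _.
have ndy : nondecreasing_seq (series y) by apply: nondecreasing_series => n _ _.
have PE N : P N = \sum_(i < N) x i * series y (N - i)%N.
  elim: N => [|N IH]; first by rewrite /P /series/= big_nil big_ord0.
  rewrite /P seriesSr -/P IH.
  rewrite [RHS](eq_bigr (fun i : 'I_N.+1 =>
    x i * series y (N - i)%N + x i * y (N - i)%N)); last first.
    by move=> i _; rewrite subSn ?seriesSr ?mulrDr// -ltnS.
  rewrite big_split/=; congr (_ + _).
  by rewrite big_ord_recr/= subnn [series y 0%N]/series/= big_nil mulr0 addr0.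
have SE N : series x N = \sum_(i < N) x i by rewrite /series/= big_mkord.
have Ple N : P N <= series x N * series y N.
  rewrite PE SE mulr_suml; apply: ler_sum => i _.
  by rewrite ler_wpM2l// ndy// leq_subr.
have leP N : series x N * series y N <= P (N + N)%N.
  rewrite PE big_split_ord/= SE mulr_suml.
  rewrite ler_wpDr//.
    by apply: sumr_ge0 => i _; rewrite mulr_ge0// /series/= sumr_ge0.
  apply: ler_sum => i _; rewrite ler_wpM2l// ndy// -addnBA ?leq_addr//.
  by rewrite ltnW.
set l := limn (series x) * limn (series y).
have xyl : (series x \* series y) @ \oo --> l by apply: cvgM.
have ndP : nondecreasing_seq P.
  by apply: nondecreasing_series => n _ _; apply: sumr_ge0 => i _; rewrite mulr_ge0.
have P_le N : P N <= l.
  apply: (le_trans (Ple N)); rewrite ler_pM ?nondecreasing_cvgn_le//;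
  by rewrite /series/= sumr_ge0.
have cP : cvgn P.
  by apply: nondecreasing_is_cvgn => //; exists l => _ [N _ <-].
suff <- : limn P = l by [].
apply/eqP; rewrite eq_le limr_le ?[X in _ && X](_ : _ = true)//=; last by apply: nearW.
rewrite -(cvg_lim _ xyl)//; apply: limr_le; first by apply/cvg_ex; exists l.
by apply: nearW => N /=; rewrite (le_trans (leP N))// nondecreasing_cvgn_le.
Qed.

End power_series.

(** * Exchanging series with sums over the integers *)

Section sum_exchange.
Variable R : realType.

Lemma lim_series_esum (x : R^nat) : (forall n, 0 <= x n) -> cvgn (series x) ->
  (limn (series x))%:E = (\esum_(n in [set: nat]) (x n)%:E)%E.
Proof.
move=> x0 cx; rewrite -EFin_lim// -nneseries_esumT; last by move=> n; rewrite lee_fin.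
by congr (limn _); apply/funext => n; rewrite /= /series/= sumEFin.
Qed.

(** Tonelli: both sides are iterated [esum]s of nonnegative terms, hence sums over pairs that agree
    after swapping the coordinates. Finiteness of the right side gives the summability. *)
Lemma sumZ_lim_series (u : nat -> int -> R) :
  (forall n l, 0 <= u n l) -> (forall n, summableZ (u n)) ->
  (forall l, cvgn (series (u^~ l))) -> cvgn (series (fun n => sumZ (u n))) ->
  summableZ (fun l => limn (series (u^~ l))) /\
  sumZ (fun l => limn (series (u^~ l))) = limn (series (fun n => sumZ (u n))).
Proof.
move=> u0 su cu cS.
have lim0 l : 0 <= limn (series (u^~ l)).
  apply: limr_ge; first exact: cu.
  by apply: nearW => n; rewrite /series/= sumr_ge0.
have E : (\esum_(l in [set: int]) (limn (series (u^~ l)))%:E)%E =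
    (limn (series (fun n => sumZ (u n))))%:E.
  rewrite lim_series_esum//; last by move=> n; rewrite sumZ_ge0.
  under [in LHS]eq_esum do rewrite lim_series_esum//.
  under [in RHS]eq_esum do rewrite /= sumZ_ge0E//.
  rewrite !esum_esum; [|by move=> *; rewrite lee_fin..].
  rewrite (@reindex_esum _ _ _ ([set: nat] `*`` (fun=> [set: int])) _
    (fun p => (p.2, p.1)))//.
  by split => // [[a b] [a' b'] _ _ [-> ->]//|[a b] _]; exists (b, a).
have sW : summableZ (fun l => limn (series (u^~ l))).
  by apply: (ge0_summableZ lim0 (ltry (limn (series (fun n => sumZ (u n)))))); rewrite E.
by split=> //; apply: EFin_inj; rewrite sumZ_ge0E.
Qed.

End sum_exchange.

(** * The Wild sum *)

Section wild_sum.
Variables (R : realType) (K : int -> int -> R) (C : R).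
Hypothesis K_ge0 : forall k l : int, 0 <= K k l.
Hypothesis K_le : forall k l : int, K k l <= C.
Hypothesis C_gt0 : 0 < C.
Variable f0 : l1 R.
Hypothesis f0_ge0 : forall k : int, 0 <= f0 k.
Local Notation Q := (collision_l1 K_ge0 K_le).
Local Notation B := (boosted K_ge0 K_le).
Local Notation M := (mass f0).
Local Notation lam := (2 * C * M).

(** Each coefficient depends on all the previous ones, so the structural recursion carries the whole
    list [v_0, ..., v_n]. *)
Fixpoint wild_list (n : nat) : seq (l1 R) :=
  if n is m.+1 then
    let s := wild_list m in
    rcons s ((lam * n%:R)^-1 *: \sum_(i < n) B (nth 0 s i) (nth 0 s (m - i)))
  else [:: f0].

Definition wild n : l1 R := nth 0 (wild_list n) n.

Lemma size_wild_list n : size (wild_list n) = n.+1.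
Proof. by elim: n => //= n IH; rewrite size_rcons IH. Qed.

Lemma nth_wild_list n i : (i <= n)%N -> nth 0 (wild_list n) i = wild i.
Proof.
elim: n => [|n IH]; first by rewrite leqn0 => /eqP ->.
rewrite leq_eqVlt => /predU1P[->//|]; rewrite ltnS => ni.
by rewrite /= nth_rcons size_wild_list ltnS ni IH.
Qed.

(* If [M = 0] the inverse below is [0], so that [wild n.+1 = 0]. *)
Lemma wildS n : wild n.+1 =
  (lam * n.+1%:R)^-1 *: \sum_(i < n.+1) B (wild i) (wild (n - i)%N).
Proof.
rewrite {1}/wild /= nth_rcons size_wild_list ltnn eqxx; congr (_ *: _).
by apply: eq_bigr => i _; rewrite !nth_wild_list ?leq_subr// -ltnS.
Qed.

Let M_ge0 : 0 <= M.
Proof. by apply: sumZ_ge0 => //; exact: l1_summable. Qed.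

Let C_neq0 : C != 0. Proof. by rewrite gt_eqF. Qed.

Let lam_ge0 : 0 <= lam. Proof. by rewrite !mulr_ge0// ltW. Qed.

Lemma wild_ge0 n k : 0 <= wild n k.
Proof.
elim/ltn_ind: n k => -[|n] IH k; first exact: f0_ge0.
rewrite wildS l1Z l1_sum; apply: mulr_ge0.
  by rewrite invr_ge0; apply: mulr_ge0; [exact: lam_ge0|].
apply: sumr_ge0 => i _; apply: boosted_ge0 => j; apply: IH => //.
by rewrite ltnS leq_subr.
Qed.

(** By [mass_boosted] each of the [n + 1] summands of the recursion has mass [lam * M], which the
    prefactor averages back to [M]. *)
Lemma mass_wild n : mass (wild n) = M.
Proof.
elim/ltn_ind: n => -[|n] IH //.
rewrite wildS massZ mass_sum.
rewrite (eq_bigr (fun=> lam * M)); last first.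
  by move=> i _; rewrite mass_boosted !IH// ltnS leq_subr.
rewrite sumr_const card_ord -(mulr_natr (lam * M)).
have [M0|M0] := eqVneq M 0; first by rewrite M0 !(mulr0, mul0r).
rewrite [lam * M * _]mulrAC mulrA mulVf ?mul1r//.
by rewrite !mulf_neq0// ?pnatr_eq0// C_neq0.
Qed.

Lemma norm_wild n : `|wild n| = M.
Proof. by rewrite ge0_l1_norm ?mass_wild//; exact: wild_ge0. Qed.

(** The recursion without division, valid also for [M = 0]: then every summand on the right is
    nonnegative of mass 0, hence zero. *)
Lemma wild_rec n :
  (lam * n.+1%:R) *: wild n.+1 = \sum_(i < n.+1) B (wild i) (wild (n - i)%N).
Proof.
have [M0|M0] := eqVneq M 0; last first.
  by rewrite wildS scalerA mulfV ?scale1r// !mulf_neq0// ?pnatr_eq0// C_neq0.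
rewrite M0 mulr0 mul0r scale0r big1// => i _; apply/normr0_eq0.
rewrite ge0_l1_norm; last by apply: boosted_ge0; exact: wild_ge0.
by rewrite mass_boosted !mass_wild M0 mulr0.
Qed.

Lemma wild_le n k : `|wild n k| <= M.
Proof. by rewrite -(norm_wild n) l1_eval_le_norm. Qed.

(** [insubd] returns the default 0 if the coordinatewise limits are not summable; [wild_seriesE]
    excludes this for [0 <= z < 1]. *)
Definition wild_series (z : R) : l1 R :=
  insubd 0 (fun k => limn (pseries (wild^~ k) z)).

(** * The Wild series at a fixed parameter in [0, 1) *)

Section fixed_time.
Variable z : R.
Hypothesis z_ge0 : 0 <= z.
Hypothesis z_lt1 : z < 1.

Let z_norm : `|z| < 1. Proof. by rewrite ger0_norm. Qed.

(** Bounded nonnegative weights keep every term nonnegative and the coefficients bounded by [c * M],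
    so [sumZ_lim_series] applies. Constant weight 1 gives summability and mass; kernel rows and
    columns give the factors of the quadratic terms. *)
Lemma wild_exchange (a : int -> R) (c : R) :
  (forall l, 0 <= a l) -> (forall l, a l <= c) ->
  let W l := limn (pseries (wild^~ l) z) in
  [/\ summableZ (fun l => a l * W l),
      cvgn (pseries (fun n => sumZ (fun l => a l * wild n l)) z)
    & sumZ (fun l => a l * W l) =
      limn (pseries (fun n => sumZ (fun l => a l * wild n l)) z)].
Proof.
move=> a0 ac W.
have aB (k l : int) : `|a l| <= c by rewrite ger0_norm.
have sa n : summableZ (fun l => a l * wild n l) by exact: (kernel_summable aB 0).
have cW l : cvgn (pseries (wild^~ l) z).
  by apply: (@cvg_pseries_bounded _ _ M) => // n; exact: wild_le.
have cS : cvgn (pseries (fun n => sumZ (fun l => a l * wild n l)) z).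
  apply: (@cvg_pseries_bounded _ _ (c * M)) => // n.
  by rewrite -(norm_wild n); exact: (kernel_sum_le aB 0).
pose u n l := z ^+ n * (a l * wild n l).
have uS : (fun n => sumZ (u n)) = (fun n => sumZ (fun l => a l * wild n l) * z ^+ n).
  by apply/funext => n; rewrite sumZM// mulrC.
have uW l : series (u^~ l) = a l *: pseries (wild^~ l) z.
  rewrite -seriesZ; congr series; apply/funext => n.
  by rewrite /u [RHS]mulrA mulrC.
have [||||] := @sumZ_lim_series R u.
- by move=> n l; rewrite !mulr_ge0 ?exprn_ge0// wild_ge0.
- by move=> n; exact: summableZM.
- by move=> l; rewrite uW; exact: is_cvgZr.
- by rewrite uS.
rewrite uS (_ : (fun l => limn _) = (fun l => a l * W l)) => [? ?|]; first by split.
by apply/funext => l; rewrite uW; apply: cvg_lim => //; apply: cvgZr; exact: cW.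
Qed.

Lemma wild_seriesE k : wild_series z k = limn (pseries (wild^~ k) z).
Proof.
have [sW _ _] := @wild_exchange (fun=> 1) 1 (fun=> ler01) (fun=> lexx 1).
rewrite [LHS](_ : _ = val (wild_series z) k)// insubdK//; apply/mem_set.
by apply: (summableZ_bound (c := 1) sW) => l; rewrite mul1r mul1r.
Qed.

Lemma wild_series_ge0 k : 0 <= wild_series z k.
Proof.
rewrite wild_seriesE; apply: limr_ge.
  by apply: (@cvg_pseries_bounded _ _ M) => // n; exact: wild_le.
by apply: nearW => n; apply: sumr_ge0 => i _; rewrite mulr_ge0 ?exprn_ge0// wild_ge0.
Qed.

Lemma mass_wild_series : mass (wild_series z) = M / (1 - z).
Proof.
have [_ _] := @wild_exchange (fun=> 1) 1 (fun=> ler01) (fun=> lexx 1).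
rewrite /mass (_ : (fun l => 1 * _) = wild_series z); last first.
  by apply/funext => l; rewrite mul1r wild_seriesE.
move=> ->; apply: cvg_lim => //.
rewrite (_ : pseries _ z = series (geometric M z)); first exact: cvg_geometric_series.
congr series; apply/funext => n /=; rewrite -(mass_wild n) /mass.
by congr (sumZ _ * _); apply/funext => l; rewrite mul1r.
Qed.

(** Writing [z ^+ n] as [z ^+ i * z ^+ (n - i)] exhibits the Cauchy product of two scalar series
    with nonnegative terms. *)
Lemma cvg_wild_product (a : int -> R) (c : R) (j : int) :
  (forall l, 0 <= a l) -> (forall l, a l <= c) ->
  pseries (fun n => \sum_(i < n.+1) wild i j * sumZ (fun l => a l * wild (n - i)%N l)) z
    @ \oo --> wild_series z j * sumZ (fun l => a l * wild_series z l).
Proof.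
move=> a0 ac; have [_ cS SE] := wild_exchange a0 ac.
have aB (k l : int) : `|a l| <= c by rewrite ger0_norm.
rewrite wild_seriesE (_ : (fun l => a l * wild_series z l) =
    (fun l => a l * limn (pseries (wild^~ l) z))); last first.
  by apply/funext => l; rewrite wild_seriesE.
rewrite SE.
rewrite [X in X @ _ --> _](_ : _ = series (fun n => \sum_(i < n.+1)
    (wild i j * z ^+ i) * (sumZ (fun l => a l * wild (n - i)%N l) * z ^+ (n - i)))); last first.
  congr series; apply/funext => n; rewrite /= mulr_suml; apply: eq_bigr => i _.
  by rewrite mulrACA -exprD subnKC// -ltnS.
apply: (@cvg_cauchy_product R (fun n => wild n j * z ^+ n)
   (fun n => sumZ (fun l => a l * wild n l) * z ^+ n)) => //.
- by move=> n; rewrite mulr_ge0 ?exprn_ge0// wild_ge0.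
- move=> n; rewrite mulr_ge0 ?exprn_ge0// sumZ_ge0//; first exact: (kernel_summable aB 0).
  by move=> l; rewrite mulr_ge0// wild_ge0.
- by apply: (@cvg_pseries_bounded _ _ M) => // n; exact: wild_le.
Qed.

Lemma cvg_wild_boosted k :
  pseries (fun n => (\sum_(i < n.+1) B (wild i) (wild (n - i)%N)) k) z @ \oo -->
    B (wild_series z) (wild_series z) k.
Proof.
rewrite boostedE.
have cb l : 0 <= 2 * C - K k l - K l k by have := K_le k l; have := K_le l k; lra.
have cB l : 2 * C - K k l - K l k <= 2 * C by have := K_ge0 k l; have := K_ge0 l k; lra.
have H1 := @cvg_wild_product (fun l => K l (k - 1)) C (k - 1)
  (fun=> K_ge0 _ _) (fun=> K_le _ _).
have H2 := @cvg_wild_product (fun l => K (k + 1) l) C (k + 1)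
  (fun=> K_ge0 _ _) (fun=> K_le _ _).
have H3 := @cvg_wild_product _ _ k cb cB.
pose T j (a : int -> R) n :=
  \sum_(i < n.+1) wild i j * sumZ (fun l => a l * wild (n - i)%N l).
have -> : pseries (fun n => (\sum_(i < n.+1) B (wild i) (wild (n - i)%N)) k) z =
    pseries (T (k - 1) (fun l => K l (k - 1))) z
    + pseries (T (k + 1) (fun l => K (k + 1) l)) z
    + pseries (T k (fun l => 2 * C - K k l - K l k)) z;
  last exact: cvgD (cvgD H1 H2) H3.
rewrite /pseries -!seriesD; congr series; apply/funext => n.
rewrite !fctE -!mulrDl; congr (_ * _).
by rewrite /T -!big_split l1_sum; apply: eq_bigr => i _; rewrite boostedE.
Qed.

(** This is the equation [lam du/dz = B(u, u)] at coordinate [k]: by [wild_rec] both series have the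
    same coefficients. *)
Lemma lim_wild_diffs k :
  lam * limn (pseries (pseries_diffs (wild^~ k)) z) = B (wild_series z) (wild_series z) k.
Proof.
rewrite -(cvg_lim _ (@cvg_wild_boosted k))//; apply/esym/cvg_lim => //.
have -> : pseries (fun n => (\sum_(i < n.+1) B (wild i) (wild (n - i)%N)) k) z =
    lam *: pseries (pseries_diffs (wild^~ k)) z.
  rewrite -seriesZ; congr series; apply/funext => n.
  transitivity (((lam * n.+1%:R) *: wild n.+1) k * z ^+ n); first by rewrite wild_rec.
  transitivity (lam * (n.+1%:R * wild n.+1 k * z ^+ n)); last by [].
  by rewrite l1Z !mulrA.
apply: cvgZr; apply: cvg_pseries_diffs => // x x1.
by apply: (@cvg_pseries_bounded _ _ M) => // n; exact: wild_le.
Qed.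

End fixed_time.

(** * Return to the time variable *)

Definition wild_solution (t : R) : l1 R :=
  expR (- lam * t) *: wild_series (1 - expR (- lam * t)).

Let expR_le1 (t : R) : 0 <= t -> expR (- lam * t) <= 1.
Proof.
move=> t0; rewrite -[leRHS]expR0 ler_expR mulNr oppr_le0.
by apply: mulr_ge0; [exact: lam_ge0|].
Qed.

Let z_ge0 (t : R) : 0 <= t -> 0 <= 1 - expR (- lam * t).
Proof. by move=> t0; rewrite subr_ge0 expR_le1. Qed.

Let z_lt1 (t : R) : 1 - expR (- lam * t) < 1.
Proof. by rewrite gtrBl expR_gt0. Qed.

Lemma wild_solution_ge0 (t : R) k : 0 <= t -> 0 <= wild_solution t k.
Proof.
by move=> t0; rewrite l1Z mulr_ge0 ?expR_ge0// wild_series_ge0//; exact: z_ge0.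
Qed.

(** The prefactor [expR (- lam * t)] is [1 - z], which cancels the growth [M / (1 - z)] of the
    series. *)
Lemma mass_wild_solution (t : R) : 0 <= t -> mass (wild_solution t) = M.
Proof.
move=> t0; rewrite massZ mass_wild_series//; last exact: z_ge0.
by rewrite opprB addrC subrK mulrC divfK// gt_eqF// expR_gt0.
Qed.

Lemma wild_solution0 : wild_solution 0 = f0.
Proof.
rewrite /wild_solution mulr0 expR0 scale1r subrr; apply: l1P => k.
by rewrite wild_seriesE// lim_pseries0.
Qed.

(** A scalar formula with a two-sided derivative even at [s = 0]; [GE] identifies it with the
    coordinate of [wild_solution] for [s >= 0]. *)
Let G k (s : R) := expR (- lam * s) * limn (pseries (wild^~ k) (1 - expR (- lam * s))).

Let GE k (s : R) : 0 <= s -> wild_solution s k = G k s.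
Proof. by move=> s0; rewrite l1Z wild_seriesE//; exact: z_ge0. Qed.

Let G_der k (s : R) : 0 <= s -> is_derive s 1 (G k) (Q (wild_solution s) k).
Proof.
move=> s0; have zs0 := z_ge0 s0; have zs1 := z_lt1 s.
pose e (x : R) := expR (- lam * x); pose w (x : R) := limn (pseries (wild^~ k) x).
have de : is_derive s 1 e (e s * - lam).
  apply: (is_derive1_comp (f := expR) (g := fun x : R => - lam * x)).
  have := @is_deriveZ R R^o R^o id (- lam) s 1 1 (is_derive_id _ _).
  by rewrite /GRing.scale/= mulr1.
have dz : is_derive s 1 (cst 1 - e) (0 - e s * - lam) by apply: is_deriveB.
have dw : is_derive (1 - e s) 1 w (limn (pseries (pseries_diffs (wild^~ k)) (1 - e s))).
  apply: (@is_derive_pseries R _ M); first by move=> n; exact: wild_le.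
  by rewrite ger0_norm.
have dwz := is_derive1_comp (f := w) (g := cst 1 - e) dw dz.
have := is_deriveM de dwz.
rewrite (_ : e * _ = G k)// => H; apply: (is_derive_eq H) => {H}.
(* Constancy of the mass, already established, makes the boost exactly [lam] times the solution. *)
have QE : Q (wild_solution s) =
    B (wild_solution s) (wild_solution s) - lam *: wild_solution s.
  by rewrite boosted_diag mass_wild_solution// addrK.
(* In the product rule, differentiating the exponential gives [- lam *: wild_solution s]; the other
   term carries the exponential squared, which the quadratic homogeneity of the boosted form
   absorbs. *)
rewrite QE l1B boostedZ !l1Z -lim_wild_diffs// wild_seriesE// -/(e s) -/(w _).
rewrite /GRing.scale/= !fctE /cst; ring.
Qed.

(** Nonnegativity turns the conserved mass into a constant norm, which is the uniform bound asked
    for by [weak_solution_is_solution]. *)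
Lemma wild_solution_is_solution : is_solution K f0 +oo%E wild_solution.
Proof.
have := @weak_solution_is_solution _ _ _ K_ge0 K_le wild_solution M.
rewrite wild_solution0; apply.
- move=> t t0; rewrite ge0_l1_norm ?mass_wild_solution// => k.
  exact: wild_solution_ge0.
- move=> k b; apply: (@subspace_eq_continuous _ _ _ (G k)).
    by move=> s; rewrite inE/= in_itv/= => /andP[s0 _]; exact/esym/GE.
  apply: derivable_within_continuous => s; rewrite in_itv/= => /andP[s0 _].
  by have := G_der k s0 => ?; exact: ex_derive.
- move=> k s s0; apply: near_eq_is_derive (G_der k (ltW s0)).
  near=> x; apply/esym/GE/ltW; near: x; exact: lt_nbhsr.
Unshelve. all: by end_near. Qed.

End wild_sum.

(** * Global existence, uniqueness and mass conservation *)

Theorem corollary2p5 (R : realType) (K : int -> int -> R) (CK : R)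
    (hK0 : forall k l : int, 0 <= K k l)
    (hCK : 0 < CK)
    (hK : (ereal_sup (range (fun kl : int * int => (K kl.1 kl.2)%:E)) <= CK%:E)%E)
    (f0 : l1 R) (hf0 : forall k : int, 0 <= f0 k) :
  exists (T : \bar R) (f : R -> l1 R),
    [/\ is_maximal_solution K f0 T f /\
        (forall (S : \bar R) (g : R -> l1 R), is_maximal_solution K f0 S g ->
           S = T /\ forall t : R, 0 <= t -> (t%:E < T)%E -> g t = f t),
        T = +oo%E,
        forall (t : R) (k : int), 0 <= t -> 0 <= f t k
      & forall t : R, 0 <= t -> mass (f t) = mass f0].
Proof.
have hK1 k l : K k l <= CK.
  rewrite -lee_fin; apply: le_trans hK; apply: ereal_sup_ubound.
  by exists (k, l).
have solf := wild_solution_is_solution hK0 hK1 hCK hf0.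
set f := wild_solution hK0 hK1 f0 in solf.
have f00 : f 0 = f0 by case: solf.
exists +oo%E, f; split => //.
- split; first by split=> // S g _; rewrite leye_eq => /eqP.
  move=> S g [solg maxg].
  (* Restricting [f] to [[0, S)] puts it on the same interval as [g], so that uniqueness compares
     them. *)
  have solfS : is_solution K f0 S f.
    case: solf => _ [df [cdf ddf d0]] _ Qf; case: solg => S0 _ _ _.
    split=> //.
      exists df; split=> //.
        by apply: continuous_subspaceW cdf => t [t0 _]; split=> //; exact: ltry.
      by move=> t t0 _; apply: ddf => //; exact: ltry.
    by move=> t t0 _; apply: Qf => //; exact: ltry.
  have gf t : 0 <= t -> (t%:E < S)%E -> g t = f t.
    by rewrite -f00 in solfS solg; exact: (solution_unique hK0 hK1 solfS solg).
  (* The global solution [f] extends [g], so maximality of [g] forces its existence time to be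
     infinite. *)
  have SE : S = +oo%E.
    by apply/esym; apply: (maxg _ f solf); [exact: leey|move=> t t0 tS; rewrite gf].
  by split=> //; rewrite -SE.
- exact: wild_solution_ge0.
- exact: mass_wild_solution.
Qed.
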